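(* For all integers $k,n$ with $1\le k\le n$, $$\sum_{i=0}^{k-1}\sum_{j=k}^{n}(-1)^{i+j-1}\binom{n}{i}\binom{n}{j}\frac{1}{j-i} = \sum_{i=0}^{k-1}\binom{n}{i}^2\left(H_{n-i}-H_i\right).$$
   Context: $H_N=\sum_{k=1}^N k^{-1}$ is the $N$th harmonic number for $N\ge1$, and $H_0:=0$. *)

(* Defs.v *)
From mathcomp Require Import all_boot all_order all_algebra.

Set Implicit Arguments.
Unset Strict Implicit.
Unset Printing Implicit Defensive.

Import GRing.Theory.
Local Open Scope ring_scope.

(* The empty sum gives H_0 = 0. *)
Definition harmonic_number (N : nat) : rat := \sum_(1 <= m < N.+1) m%:R^-1.

(* Main.v *)
Require Import Defs.
From mathcomp Require Import all_boot all_order all_algebra.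
From mathcomp Require Import ring.

(** The summand of the left-hand side is antisymmetric in [i] and [j], so its
sum over the square [0 <= i, j < k] vanishes, provided that the diagonal terms
are discarded. Adding that square to the rectangle [i < k <= j] turns the
left-hand side into full rows [0 <= j <= n], and the proposition follows row by
row from
[\sum_(j != i) (-1)^j 'C(n, j) / (j - i) = - (-1)^i 'C(n, i) (H_(n-i) - H_i)].

The convention [0^-1 = 0] discards the diagonal terms without any side
condition. The row sum is then the value at [x = i] of
[binom_inv_sum n x = \sum_(j <= n) (-1)^j 'C(n, j) / (j - x)], a function of a
rational variable. Pascal's rule makes it satisfy the recurrence
[binom_inv_sum n.+1 x = binom_inv_sum n x - binom_inv_sum n (x - 1)]
([binom_inv_sumS]), and the right-hand side of the row identity satisfies the
same recurrence because [i 'C(n, i) = (n - i + 1) 'C(n, i - 1)]. For [x] in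
[{0, ..., n.+1}] the recurrence leaves the range [{0, ..., n}] at the two points
[-1] and [n.+1], where the sum is elementary ([binom_inv_sumN1] and
[binom_inv_sum_succ]). *)

Set Implicit Arguments.
Unset Strict Implicit.
Unset Printing Implicit Defensive.

Import Order.TTheory GRing.Theory Num.Theory.
Local Open Scope ring_scope.

(** With [0^-1 = 0], the term [j = x] contributes nothing when [x] is a pole. *)
Definition binom_inv_sum (n : nat) (x : rat) : rat :=
  \sum_(0 <= j < n.+1) (-1) ^+ j * 'C(n, j)%:R * (j%:R - x)^-1.

Lemma harmonic_numberS n :
  harmonic_number n.+1 = harmonic_number n + n.+1%:R^-1.
Proof. by rewrite /harmonic_number big_nat_recr. Qed.

Lemma sum_alternating_binom (R : comNzRingType) n :
  \sum_(0 <= j < n.+2) (-1) ^+ j * 'C(n.+1, j)%:R = 0 :> R.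
Proof.
have := exprBn (1 : R) 1 n.+1; rewrite subrr expr0n mulr0n => sum0; rewrite [RHS]sum0.
rewrite big_mkord; apply: eq_bigr => j _.
by rewrite !expr1n !mulr1 mulr_natr.
Qed.

Lemma binom_inv_sumS n x :
  binom_inv_sum n.+1 x = binom_inv_sum n x - binom_inv_sum n (x - 1).
Proof.
rewrite /binom_inv_sum big_nat_recl // -sumrN.
under eq_bigr => j _ do rewrite binS natrD mulrDr mulrDl.
rewrite big_split /= addrA; congr (_ + _); last first.
  by apply: eq_bigr => j _; rewrite exprS -natr1 opprB addrA; ring.
rewrite [RHS]big_nat_recl //; congr (_ + _); first by rewrite !bin0.
(* The last term of the left-hand sum is zero since 'C(n, n.+1) = 0. *)
by rewrite big_nat_recr //= bin_small // mulr0 mul0r addr0.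
Qed.

(** Absorption ['C(n, j) / (j + 1) = 'C(n.+1, j.+1) / (n + 1)] reduces the sum
to an alternating row of Pascal's triangle without its first entry. *)
Lemma binom_inv_sumN1 n : binom_inv_sum n (-1) = n.+1%:R^-1.
Proof.
have := sum_alternating_binom rat n.
rewrite big_nat_recl // expr0 bin0 mulr1 => /eqP; rewrite addr_eq0 => /eqP H1.
rewrite -[RHS]mul1r [X in _ = X * _]H1 -sumrN big_distrl /=.
apply: eq_bigr => j _.
have /(congr1 (fun m => m%:R : rat)) := mul_bin_diag n.+1 j.
rewrite !natrM => Hb; rewrite exprS opprK natr1.
have Hn : n.+1%:R != 0 :> rat by rewrite pnatr_eq0.
have Hj : j.+1%:R != 0 :> rat by rewrite pnatr_eq0.
apply: (mulIf Hn); apply: (mulIf Hj); rewrite mulN1r mulNr opprK mulfVK //.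
rewrite mulrAC mulfVK // -!mulrA; congr (_ * _).
by rewrite mulrC Hb mulrC.
Qed.

(** Absorption ['C(n, j) / (n + 1 - j) = 'C(n.+1, j) / (n + 1)] reduces the sum
to an alternating row of Pascal's triangle without its last entry. *)
Lemma binom_inv_sum_succ n :
  binom_inv_sum n n.+1%:R = (-1) ^+ n.+1 / n.+1%:R.
Proof.
have := sum_alternating_binom rat n.
rewrite big_nat_recr //= binn mulr1 => /eqP; rewrite addrC addr_eq0 => /eqP ->.
rewrite -sumrN big_distrl /=; apply: eq_big_nat => j /andP[_ lejn].
have /(congr1 (fun m => m%:R : rat)) := mul_bin_down n.+1 j.
rewrite !natrM natrB 1?ltnW //= => Hb.
have Hn : n.+1%:R != 0 :> rat by rewrite pnatr_eq0.
have Hj : j%:R - n.+1%:R != 0 :> rat by rewrite subr_eq0 eqr_nat ltn_eqF.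
apply: (mulIf Hn); apply: (mulIf Hj); rewrite mulfVK // mulrAC mulfVK //.
rewrite -mulrA [_ * n.+1%:R]mulrC Hb; ring.
Qed.

(** Induction on [n]: since ['C(n, i.+1) / (n - i) = 'C(n, i) / (i + 1)], the
corrections that turn the four harmonic numbers of the recurrence into
[harmonic_number (n - i)] and [harmonic_number i.+1] cancel. *)
Lemma binom_inv_sum_nat n i : (i <= n)%N ->
  binom_inv_sum n i%:R =
  - (-1) ^+ i * 'C(n, i)%:R * (harmonic_number (n - i) - harmonic_number i).
Proof.
elim: n i => [|n IHn] [|i] // lein.
- by rewrite /binom_inv_sum big_nat1 !subrr invr0 !mulr0.
- rewrite binom_inv_sumS IHn // sub0r binom_inv_sumN1 !subn0 harmonic_numberS.
  by rewrite !bin0; ring.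
rewrite binom_inv_sumS subSS -{2}(natr1 i) addrK (IHn i) //.
have := lein; rewrite ltnS leq_eqVlt => /predU1P[->|ltin].
  rewrite binom_inv_sum_succ !binn !subnn harmonic_numberS exprS; ring.
rewrite IHn // -(subnSK ltin) binS natrD !harmonic_numberS exprS.
have /(congr1 (fun m => m%:R : rat)) := mul_bin_left n i.
rewrite !natrM -(subnSK ltin) => Hb.
set d := (n - i.+1)%N in Hb *.
have Hi : i.+1%:R != 0 :> rat by rewrite pnatr_eq0.
have Hd : d.+1%:R != 0 :> rat by rewrite pnatr_eq0.
have -> : 'C(n, i.+1)%:R = d.+1%:R * 'C(n, i)%:R / i.+1%:R :> rat.
  by rewrite -Hb mulrAC divff // mul1r.
move: Hi Hd; move: i.+1%:R d.+1%:R => p q Hp Hq; field.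
by rewrite Hp Hq.
Qed.

Lemma sum_antisymmetric (R : numDomainType) (F : nat -> nat -> R) k :
  (forall i j, F i j = - F j i) ->
  \sum_(0 <= i < k) \sum_(0 <= j < k) F i j = 0.
Proof.
move=> Fanti; apply/eqP; rewrite -eqNr -sumrN [X in _ == X]exchange_big /=.
apply/eqP; apply: eq_bigr => i _; rewrite -sumrN.
by apply: eq_bigr => j _; rewrite -Fanti.
Qed.

(* MathComp world. The natural-number subtractions i + j - 1 and n - i never
   truncate, since j >= k >= 1 and i < k <= n; j - i is taken in rat and is
   nonzero, since i < k <= j. *)
Theorem proposition10 (k n : nat) (hk : (1 <= k)%N) (hkn : (k <= n)%N) :
  \sum_(0 <= i < k) \sum_(k <= j < n.+1)
     (-1) ^+ (i + j - 1)%N * 'C(n, i)%:R * 'C(n, j)%:R * (1 / (j%:R - i%:R))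
  = \sum_(0 <= i < k)
      'C(n, i)%:R ^+ 2 * (harmonic_number (n - i)%N - harmonic_number i) :> rat.
Proof.
pose F i j : rat :=
  - (-1) ^+ (i + j) * 'C(n, i)%:R * 'C(n, j)%:R * (j%:R - i%:R)^-1.
have Fanti i j : F i j = - F j i.
  by rewrite /F addnC -(opprB i%:R) invrN; ring.
transitivity (\sum_(0 <= i < k) \sum_(k <= j < n.+1) F i j).
  apply: eq_bigr => i _; apply: eq_big_nat => j /andP[lekj _].
  (* j >= 1, so the exponent i + j - 1 is a genuine predecessor. *)
  have [m ->] : exists m, j = m.+1.
    by case: j lekj (leq_trans hk lekj) => // m; exists m.
  by rewrite /F addnS subn1 /= exprS mul1r; ring.
rewrite -[LHS]add0r -[X in X + _](sum_antisymmetric k Fanti) -big_split /=.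
apply: eq_big_nat => i /andP[_ ltik].
rewrite -big_cat_nat //=; last exact: leqW.
have := binom_inv_sum_nat (ltnW (leq_trans ltik hkn)).
move=> /(congr1 (fun s => - (-1) ^+ i * 'C(n, i)%:R * s)).
rewrite {1}/binom_inv_sum big_distrr /= => Hrow.
transitivity (- (-1) ^+ i * 'C(n, i)%:R *
  (- (-1) ^+ i * 'C(n, i)%:R * (harmonic_number (n - i) - harmonic_number i))
  : rat).
  by rewrite -Hrow; apply: eq_bigr => j _; rewrite /F exprD; ring.
have sgn2 : (-1) ^+ i * (-1) ^+ i = 1 :> rat by rewrite -expr2 sqrr_sign.
rewrite -[RHS]mul1r -[X in _ = X * _]sgn2; ring.
Qed.
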